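(* Let $a<b$ and let $\gamma_{\mathrm{geo}}$ be a kinetically admissible path on $[a,b]$. Suppose that for every kinetically admissible path $\gamma_{\mathrm{other}}$ on $[a,b]$ with $\gamma_{\mathrm{other}}(a)=\gamma_{\mathrm{geo}}(a)$ and $\gamma_{\mathrm{other}}(b)=\gamma_{\mathrm{geo}}(b)$ there exists some $s_0\in(0,1)$ (possibly depending on $\gamma_{\mathrm{other}}$) with $$\mathcal{A}[\gamma_{\mathrm{geo}}]\le\mathcal{A}[\mathrm{interp}^\times(\gamma_{\mathrm{geo}},\gamma_{\mathrm{other}},s_0)].$$ Then $\gamma_{\mathrm{geo}}$ is a global minimizer of $\mathcal{A}$ among kinetically admissible paths on $[a,b]$ sharing its endpoints.
   Context: For $a<b$, an admissible path on $[a,b]$ is an absolutely continuous function $\gamma:[a,b]\to(0,\infty)$ (strictly positive at every point) with $\dot\gamma\in L^2([a,b])$. Its log-coordinate is $\xi:=\log\gamma$, which is absolutely continuous with $\dot\xi=\dot\gamma/\gamma\in L^2([a,b])$. An admissible path $\gamma$ is kinetically admissible if $\int_a^b[\cosh(\dot\xi(t))-1]\,dt<\infty$. For a kinetically admissible path the kinetic action is $\mathcal{A}[\gamma]:=\int_a^b[\cosh(\dot\xi(t))-1]\,dt$. Geometric interpolation of admissible $\gamma_1,\gamma_2$ with $s\in[0,1]$ is $\mathrm{interp}^\times(\gamma_1,\gamma_2,s)(t):=\gamma_1(t)^{1-s}\gamma_2(t)^s$ (it is kinetically admissible whenever $\gamma_1,\gamma_2$ are). *)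

(* Defs.v *)
From mathcomp Require Import all_boot all_order all_algebra.
From mathcomp Require Import all_classical all_reals all_analysis.
Import Order.TTheory GRing.Theory Num.Theory.
Import numFieldNormedType.Exports.
Set Implicit Arguments.
Unset Strict Implicit.
Unset Printing Implicit Defensive.
Local Open Scope classical_set_scope.
Local Open Scope ring_scope.

(* Paths are total functions R -> R of which only the restriction to [a, b]
   matters: every condition below is local to [a, b], and a derivative at an
   interior point depends only on the values near that point.  The endpoints,
   where the two-sided derivative may see values outside [a, b], form a
   Lebesgue-null set. *)

Definition coshR (R : realType) (x : R) : R := (expR x + expR (- x)) / 2.

(* Degenerate intervals (u i = v i) are allowed: they contribute 0 to both
   sums. *)
Definition abs_continuous_on (R : realType) (a b : R) (f : R -> R) : Prop :=
  forall eps : R, 0 < eps -> exists2 delta : R, 0 < delta &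
    forall (n : nat) (u v : 'I_n -> R),
      (forall i, [/\ a <= u i, u i <= v i & v i <= b]) ->
      trivIset [set: 'I_n] (fun i => `]u i, v i[%classic : set R) ->
      \sum_(i < n) (v i - u i) < delta ->
      \sum_(i < n) `|f (v i) - f (u i)| < eps.

(* Membership in L^2([a, b]) is expressed through the extension by 0. *)
Definition L2_on (R : realType) (a b : R) (g : R -> R) : Prop :=
  (g \_ `[a, b] : R -> R) \in Lfun (@lebesgue_measure R) 2%:E.

(* derive1 is total (0 where the difference quotient has no
   limit); absolutely continuous functions are differentiable almost everywhere,
   so for them it is a version of the a.e. derivative. *)
Definition admissible (R : realType) (a b : R) (g : R -> R) : Prop :=
  [/\ {in `[a, b], forall t, 0 < g t},
      abs_continuous_on a b g
    & L2_on a b (derive1 g)].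

Definition log_coord (R : realType) (g : R -> R) : R -> R := fun t => ln (g t).

(* Valued in the extended reals; the integrand is nonnegative, and finiteness
   of the integral is precisely kinetic admissibility. *)
Definition kinetic_action (R : realType) (a b : R) (g : R -> R) : \bar R :=
  (\int[@lebesgue_measure R]_(t in `[a, b])
     (coshR (derive1 (log_coord g) t) - 1)%:E)%E.

Definition kinetically_admissible (R : realType) (a b : R) (g : R -> R) : Prop :=
  admissible a b g /\ (kinetic_action a b g < +oo)%E.

Definition geo_interp (R : realType) (g1 g2 : R -> R) (s : R) : R -> R :=
  fun t => g1 t `^ (1 - s) * g2 t `^ s.

Definition same_endpoints (R : realType) (a b : R) (g1 g2 : R -> R) : Prop :=
  g1 a = g2 a /\ g1 b = g2 b.

Definition global_minimizer (R : realType) (a b : R) (g : R -> R) : Prop :=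
  kinetically_admissible a b g /\
  forall h : R -> R, kinetically_admissible a b h -> same_endpoints a b h g ->
    (kinetic_action a b g <= kinetic_action a b h)%E.

(* Main.v *)
(* The integrand cosh - 1 is convex and log-coordinates turn geometric
   interpolation into affine interpolation, so
   A[interp s] <= (1 - s) A[geo] + s A[other]; together with
   A[geo] <= A[interp s0] and 0 < s0 this gives A[geo] <= A[other].

   The chain rule for log-coordinates is only available where the paths are
   differentiable, so the argument rests on Lebesgue's theorem that an
   absolutely continuous f is differentiable almost everywhere.  The variation
   function of f is again absolutely continuous, hence f is a difference of two
   nondecreasing absolutely continuous functions; the Stieltjes measure of such
   a function is dominated by the Lebesgue measure, and its Radon-Nikodym
   density is the derivative at every Lebesgue point. *)
From HB Require Import structures.
Require Import Defs.
From mathcomp Require Import all_boot all_order all_algebra.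
From mathcomp Require Import all_classical all_reals all_analysis.
From mathcomp Require Import measurable_realfun lra.
Import Order.TTheory GRing.Theory Num.Theory.
Import numFieldNormedType.Exports.
Local Open Scope classical_set_scope.
Local Open Scope ring_scope.

(** * Absolute continuity and total variation *)

(** Lists, unlike the families indexed by ['I_n] in [abs_continuous_on], can be concatenated, so
    that an interval can be exchanged for the cells of a partition. The disjunction leaves the list
    free to be unsorted. *)
Definition itv_family {R : realType} (a b : R) (s : seq (R * R)) : bool :=
  all (fun x => [&& a <= x.1, x.1 <= x.2 & x.2 <= b]) s &&
  pairwise (fun x y => (x.2 <= y.1) || (y.2 <= x.1)) s.

Definition total_length {R : realType} (s : seq (R * R)) : R :=
  \sum_(x <- s) (x.2 - x.1).

Definition total_jump {R : realType} (f : R -> R) (s : seq (R * R)) : R :=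
  \sum_(x <- s) `|f x.2 - f x.1|.

(** The final inequality is not strict, so that it survives the suprema that define total
    variation. *)
Definition jump_continuous {R : realType} (a b : R) (f : R -> R) : Prop :=
  forall eps : R, 0 < eps -> exists2 delta : R, 0 < delta &
    forall s, itv_family a b s -> total_length s < delta ->
      total_jump f s <= eps.

Lemma abs_continuous_jump {R : realType} (a b : R) (f : R -> R) :
  abs_continuous_on a b f -> jump_continuous a b f.
Proof.
move=> fac eps /fac[d d0 H]; exists d => // s /andP[/allP sin spw].
rewrite /total_length /total_jump !(big_tnth _ _ s) => sd; apply/ltW.
apply: (H _ (fun i => (tnth (in_tuple s) i).1)
            (fun i => (tnth (in_tuple s) i).2)) => //.
- by move=> i; apply/and3P; exact: (sin _ (mem_tnth i (in_tuple s))).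
- move=> i j _ _ [x [/=]]; rewrite !in_itv/= => /andP[xi ix] /andP[xj jx].
  apply/eqP/negP => /negP.
  wlog ij : i j xi ix xj jx / (i < j)%N => [hw|_].
    case: (ltngtP i j) => [ij|ji|/val_inj->]; last by rewrite eqxx.
    + exact: hw ij.
    + by rewrite eq_sym; exact: hw ji.
  move: spw => /(pairwiseP (0, 0)) /(_ i j (ltn_ord i) (ltn_ord j) ij).
  rewrite -!(tnth_nth _ (in_tuple s)) => /orP[] h.
    by have := lt_le_trans ix (le_trans h (ltW xj)); rewrite ltxx.
  by have := lt_le_trans jx (le_trans h (ltW xi)); rewrite ltxx.
Qed.

Lemma partition_family {R : realType} (f : R -> R) (u v : R) (l : seq R) :
  itv_partition u v l -> exists c, [/\ itv_family u v c,
    total_length c = v - u & total_jump f c = variation u v f l].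
Proof.
elim: l u => [u /itv_partition_nil ->|x l ih u pl].
  exists [::]; rewrite /total_length /total_jump !big_nil variation_nil subrr.
  by [].
have [c [/andP[/allP cin cpw] cl cj]] := ih _ (itv_partition_cons pl).
have ux : u <= x by case: pl => /= /andP[/ltW].
have xv : x <= v := itv_partition_le (itv_partition_cons pl).
exists ((u, x) :: c); split.
- rewrite /itv_family/= lexx ux xv cpw/= andbT; apply/andP; split.
    apply/allP => z /cin /and3P[xz -> ->].
    by rewrite (le_trans ux xz).
  by apply/allP => z /cin /and3P[xz _ _]/=; rewrite xz.
- by rewrite /total_length big_cons/= -/(total_length c) cl; lra.
- rewrite /total_jump big_cons/= -/(total_jump f c) cj.
  by rewrite /variation [RHS]big_nat_recl.
Qed.

(* Splitting a family into [s] and [t] allows the intervals of [s] to be replaced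
   one at a time by arbitrary partitions, whose cells are moved to [t]. *)
Lemma sum_total_variation_le {R : realType} (a b eps delta : R) (f : R -> R) :
  (forall s, itv_family a b s -> total_length s < delta ->
     total_jump f s <= eps) ->
  forall s t, itv_family a b (s ++ t) -> total_length (s ++ t) < delta ->
    (\sum_(x <- s) total_variation x.1 x.2 f + (total_jump f t)%:E
       <= eps%:E)%E.
Proof.
move=> H; elim=> [|[u v] s ih] t fam len.
  by rewrite big_nil add0e lee_fin H.
move: fam; rewrite /itv_family/= -andbA => /and4P[/and3P[au uv vb] ain auv spw].
rewrite big_cons/= -addeA.
set r := (\sum_(x <- s) _ + _)%E.
have key l : itv_partition u v l -> ((variation u v f l)%:E + r <= eps%:E)%E.
  move=> /(partition_family f)[c [/andP[/allP cin cpw] cl <-]].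
  have := ih (c ++ t); rewrite /total_jump big_cat/= EFinD addeCA; apply.
    apply/andP; split.
      move: ain; rewrite !all_cat => /andP[-> ->]/=; rewrite andbT.
      apply/allP => z /cin /and3P[uz -> zv].
      by rewrite (le_trans au uz) (le_trans zv vb).
    move: auv spw; rewrite !all_cat !pairwise_cat => /andP[/allP us /allP ut].
    move=> /and3P[st -> ->]; rewrite cpw !andbT.
    rewrite allrel_catr st andbT; apply/andP; split.
      apply/allrelP => x y /us + /cin/and3P[uy _ yv] /= => /orP[vx|xu].
        by rewrite (le_trans yv vx) orbT.
      by rewrite (le_trans xu uy).
    apply/allrelP => y x /cin/and3P[uy _ yv] /ut /= => /orP[vx|xu].
      by rewrite (le_trans yv vx).
    by rewrite (le_trans xu uy) orbT.
  move: len; rewrite /total_length !(big_cons, big_cat)/= -/(total_length c) cl.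
  by rewrite addrCA.
have r0 : (0 <= r)%E.
  rewrite /r adde_ge0 ?lee_fin ?sumr_ge0//.
  rewrite big_seq sume_ge0// => x xs; apply: total_variation_ge0.
  by move: ain; rewrite all_cat => /andP[/allP/(_ _ xs)/and3P[]].
(* A degenerate interval only has the empty partition. Otherwise the one-cell partition shows that
   [r] is finite, so that it can be moved to the right before taking the supremum over
   partitions. *)
move: uv; rewrite le_eqVlt => /predU1P[uv|uv].
  subst v; have := key [::]; rewrite total_variationxx variation_nil; apply.
  by split.
have rfin : r \is a fin_num.
  rewrite ge0_fin_numE// (le_lt_trans _ (ltry eps))//.
  apply: le_trans (key _ (itv_partition1 uv)).
  by rewrite leeDr// lee_fin variation_ge0.
rewrite -leeBrDr//; apply: ge_ereal_sup => _ [_ [l pl <-] <-].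
by rewrite leeBrDr// key.
Qed.

Lemma total_variation_le_of_jump {R : realType} (a b eps delta : R) (f : R -> R) :
  (forall s, itv_family a b s -> total_length s < delta ->
     total_jump f s <= eps) ->
  forall u v, a <= u -> u <= v -> v <= b -> v - u < delta ->
    (total_variation u v f <= eps%:E)%E.
Proof.
move=> H u v au uv vb uvd.
have := @sum_total_variation_le _ _ _ _ _ _ H [:: (u, v)] [::].
rewrite /total_length /total_jump /= !big_seq1 big_nil adde0; apply => //.
by rewrite /itv_family /= au uv vb.
Qed.

(** Let [d] answer to the bound 1. Induction on the number of pieces of length at most [d / 2],
    hence below [d]: each of them has variation at most 1. *)
Lemma total_variation_fin_num {R : realType} (a b : R) (f : R -> R) :
  jump_continuous a b f ->
  forall x, a <= x -> x <= b -> total_variation a x f \is a fin_num.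
Proof.
move=> /(_ 1 ltr01)[d d0 H] x ax xb; rewrite ge0_fin_numE ?total_variation_ge0//.
have d20 : 0 < d / 2 by rewrite divr_gt0.
have [k] : exists k : nat, x - a <= k%:R * (d / 2).
  exists (Num.truncn ((x - a) / (d / 2))).+1.
  by rewrite -ler_pdivrMr// ltW// truncnS_gt.
elim: k x ax xb => [x ax xb|k ih x ax xb xk].
  rewrite mul0r subr_le0 => xa; have -> : x = a by apply/eqP; rewrite eq_le xa.
  by rewrite total_variationxx.
pose y := Num.max a (x - d / 2).
have ay : a <= y by rewrite le_max lexx.
have yx : y <= x by rewrite ge_max ax lerBlDr lerDl ltW.
rewrite (@total_variationD _ a x y)// lte_add_pinfty//.
  apply: ih => //; first exact: le_trans yx xb.
  rewrite lerBlDr ge_max; apply/andP; split.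
    by rewrite lerDr mulr_ge0// ltW.
  by move: xk; rewrite -natr1 mulrDl mul1r; lra.
apply: le_lt_trans (ltry 1); apply: total_variation_le_of_jump H _ _ _ _ _ _ => //.
have : x - d / 2 <= y by rewrite le_max lexx orbT.
lra.
Qed.

Section variation_function.
Context {R : realType} (a b : R) (f : R -> R).
Hypothesis fac : jump_continuous a b f.

Let V x := fine (total_variation a x f).

Let VB u v : a <= u -> u <= v -> v <= b ->
  (V v - V u)%:E = total_variation u v f.
Proof.
move=> au uv vb; have av := le_trans au uv; have ub := le_trans uv vb.
have fu := total_variation_fin_num _ _ _ fac _ au ub.
have fv := total_variation_fin_num _ _ _ fac _ av vb.
by rewrite EFinB !fineK// (@total_variationD _ a v u)// addeAC subee// add0e.
Qed.

Let V_jump u v : a <= u -> u <= v -> v <= b -> `|f v - f u| <= V v - V u.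
Proof. by move=> au uv vb; rewrite -lee_fin VB// total_variation_ge. Qed.

(** The decomposition is [V] minus [V \- f]. The increments of [V] are variations of [f], which
    [sum_total_variation_le] bounds along a family, and [V_jump] makes [V \- f] nondecreasing. *)
Lemma jordan_jump_continuous : exists F1 F2 : R -> R,
  [/\ f = F1 \- F2,
      {in `[a, b] &, nondecreasing_fun F1} /\ jump_continuous a b F1
    & {in `[a, b] &, nondecreasing_fun F2} /\ jump_continuous a b F2].
Proof.
have Vac : jump_continuous a b V.
  move=> eps /fac[d d0 H]; exists d => // s fs ls.
  have := @sum_total_variation_le _ _ _ _ _ _ H s [::].
  rewrite cats0 /total_jump big_nil adde0 => /(_ fs ls).
  rewrite -lee_fin; apply: le_trans; rewrite -sumEFin le_eqVlt; apply/orP; left.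
  apply/eqP; rewrite big_seq [RHS]big_seq; apply: eq_bigr => x xs.
  case/andP : fs => /allP /(_ _ xs)/and3P[ax xx xb] _.
  by rewrite -VB// ger0_norm// (le_trans _ (V_jump _ _ ax xx xb)).
have Vnd u v : a <= u -> u <= v -> v <= b -> V u <= V v.
  by move=> au uv vb; rewrite -subr_ge0 (le_trans _ (V_jump _ _ au uv vb)).
exists V, (V \- f); split.
- by apply/funext => x /=; rewrite opprB addrC subrK.
- split=> // x y; rewrite !in_itv/= => /andP[ax _] /andP[_ yb] xy.
  exact: Vnd.
- split.
    move=> x y; rewrite !in_itv/= => /andP[ax _] /andP[_ yb] xy.
    have := V_jump _ _ ax xy yb; have := ler_norm (f y - f x); lra.
  (* Half of [eps], because a jump of [V \- f] is at most twice that of [V]. *)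
  move=> eps eps0; have [d d0 H] := Vac _ (divr_gt0 eps0 (ltr0n R 2)).
  exists d => // s fs ls.
  have e2 : total_jump V s *+ 2 <= eps.
    by have := H s fs ls; lra.
  apply: le_trans e2; rewrite /total_jump -sumrMnl big_seq [leRHS]big_seq.
  apply: ler_sum => x xs.
  case/andP : fs => /allP /(_ _ xs)/and3P[ax xx xb] _.
  have := V_jump _ _ ax xx xb.
  rewrite (ger0_norm (_ : 0 <= V x.2 - V x.1)) ?subr_ge0 ?Vnd// => h /=.
  rewrite (_ : _ - _ - _ = (V x.2 - V x.1) - (f x.2 - f x.1)); last by lra.
  rewrite (le_trans (ler_normB _ _))// ger0_norm ?subr_ge0 ?Vnd//; lra.
Qed.

End variation_function.

(** * Almost everywhere differentiability *)

Lemma lebesgue_stieltjes_measure_itvoc {R : realType} (F : cumulative R R)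
    (u v : R) : u <= v ->
  lebesgue_stieltjes_measure F (`]u, v]%classic : set R) = (F v - F u)%:E.
Proof.
move=> uv; rewrite /lebesgue_stieltjes_measure /measure_extension/=.
rewrite measurable_mu_extE/=; last exact: is_ocitv.
by rewrite wlength_itv_bnd.
Qed.

Section grid.
Context {R : realType} (a b : R) (U : set R).
Hypothesis hab : a < b.

(* The grid of mesh [h n] need not refine the coarser ones; the increasing sets
   are the intersections of the tails of [approx], see [W] below. *)
Let h n : R := (b - a) / n.+1%:R.
Let node n (j : nat) : R := a + j%:R * h n.
Let cell n j : set R := `]node n j, node n j.+1]%classic.
Let inner n (j : nat) : bool := `[< cell n j `<=` U >].
Let approx n : set R := \big[setU/set0]_(j < n.+1 | inner n j) cell n j.

Let h_gt0 n : 0 < h n. Proof. by rewrite divr_gt0 ?subr_gt0. Qed.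

Let node_le n i j : (i <= j)%N -> node n i <= node n j.
Proof. by move=> ij; rewrite lerD2l ler_pM2r// ler_nat. Qed.

Let node_max n : node n n.+1 = b.
Proof. by rewrite /node /h mulrC divfK ?pnatr_eq0// subrKC. Qed.

Let trivIset_cell n : trivIset [set: 'I_n.+1] (fun j => cell n j).
Proof.
move=> i j _ _ [x [/=]]; rewrite /cell/= !in_itv/= => /andP[xi ix] /andP[xj jx].
apply: val_inj => /=; apply/eqP; rewrite eqn_leq; apply/andP; split.
  rewrite leqNgt; apply/negP => /(node_le n) ji.
  by have := lt_le_trans xi (le_trans jx ji); rewrite ltxx.
rewrite leqNgt; apply/negP => /(node_le n) ij.
by have := lt_le_trans xj (le_trans ix ij); rewrite ltxx.
Qed.

Let nodes n := [seq (node n j, node n j.+1) | j <- index_iota 0 n.+1 & inner n j].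

Let itv_family_nodes n : itv_family a b (nodes n).
Proof.
apply/andP; split.
  apply/allP => _ /mapP[j + ->] /=; rewrite mem_filter mem_index_iota.
  move=> /and3P[_ _ jn]; rewrite node_le// -{1}(node_max n) node_le//=.
  by rewrite andbT lerDl mulr_ge0// ltW.
rewrite /nodes pairwise_map; apply: (@sub_pairwise _ ltn).
  by move=> i j ij /=; rewrite node_le.
apply: pairwise_filter; rewrite -(sorted_pairwise ltn_trans).
exact: iota_ltn_sorted.
Qed.

Let sum_nodes n (G : R * R -> R) :
  \sum_(x <- nodes n) G x =
  \sum_(j < n.+1 | inner n j) G (node n j, node n j.+1).
Proof. by rewrite /nodes big_map big_filter big_mkord. Qed.

Let measure_approx (F : cumulative R R) n :
  lebesgue_stieltjes_measure F (approx n) = (\sum_(x <- nodes n) (F x.2 - F x.1))%:E.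
Proof.
rewrite (sum_nodes n (fun x => F x.2 - F x.1)) /approx.
rewrite measure_bigsetU_ord//=; last by move=> i; exact: measurable_itv.
rewrite -sumEFin; apply: eq_bigr => j _.
by rewrite lebesgue_stieltjes_measure_itvoc// node_le.
Qed.

Let approx_sub n : approx n `<=` U.
Proof.
by move=> x; rewrite /approx -bigcup_seq_cond => -[j /= /andP[_ /asboolP jU] /jU].
Qed.

(** As soon as the mesh is smaller than the radius of a ball around [x] inside [U], the cell
    containing [x] lies in that ball. *)
Let approx_cover (x : R) : open U -> U x -> a < x -> x <= b ->
  \forall n \near \oo, approx n x.
Proof.
move=> oU Ux ax xb; have /nbhs_ballP[r /= r0 rU] : nbhs x U by exact: open_nbhs_nbhs.
exists (Num.truncn ((b - a) / r)) => // n /= rn.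
have hr : h n < r.
  rewrite /h ltr_pdivrMr// mulrC -ltr_pdivrMr//.
  by rewrite (lt_le_trans (truncnS_gt _))// ler_nat.
(* The first node that is at least [x] closes the cell of [x]; its index is not 0 because node 0 is
   [a < x]. *)
have : exists k, x <= node n k by exists n.+1; rewrite node_max.
case/ex_minnP => -[|j] xj jmin.
  by move: xj; rewrite /node mul0r addr0 leNgt ax.
have jx : node n j < x by rewrite ltNge; apply/negP => /jmin; rewrite ltnn.
have jn : (j < n.+1)%N by apply: jmin; rewrite node_max.
have cx : cell n j x by rewrite /cell/= in_itv/= jx.
rewrite /approx -bigcup_seq_cond; exists (Ordinal jn) => //=.
apply/andP; split; first exact: mem_index_enum.
apply/asboolP => y; rewrite /cell/= in_itv/= => /andP[jy yj]; apply: rU.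
have nE : node n j.+1 = node n j + h n by rewrite /node -natr1 mulrDl mul1r addrA.
rewrite nE in xj yj; rewrite /ball/= ltr_norml; apply/andP; split; lra.
Qed.

(** The cells inside [U] form a family of total length at most the measure of [U], so [approx n] has
    Stieltjes measure at most [eps]. Continuity from below along [W] carries this bound to the part
    of [U] in []a, b]]. *)
Lemma stieltjes_open_le (F : cumulative R R) (eps delta : R) :
  open U ->
  (forall s, itv_family a b s -> total_length s < delta ->
     total_jump F s <= eps) ->
  (lebesgue_measure U < delta%:E)%E ->
  (lebesgue_stieltjes_measure F (U `&` `]a, b]) <= eps%:E)%E.
Proof.
move=> oU H Ud.
have mapprox n : measurable (approx n : set (measurableTypeR R)).
  by apply: bigsetU_measurable => j _; exact: measurable_itv.
have approx_le n : (lebesgue_stieltjes_measure F (approx n) <= eps%:E)%E.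
  rewrite measure_approx lee_fin; apply: le_trans (H (nodes n) _ _) => //.
  - by apply: ler_sum => x _; exact: ler_norm.
  - rewrite -lte_fin; apply: le_lt_trans Ud.
    (* Lebesgue measure is the Stieltjes measure of the identity, so [measure_approx] also computes
       total lengths. *)
    have := measure_approx idfun n.
    rewrite /total_length => <-.
    apply: (@le_measure _ _ _ (@lebesgue_measure R)) => //.
    + by rewrite inE; exact: mapprox.
    + by rewrite inE; exact: open_measurable.
pose W N := \bigcap_(n in [set n | (N <= n)%N]) approx n.
have mW N : measurable (W N : set (measurableTypeR R)).
  by apply: bigcap_measurable; [exists N => /=|].
have Wnd : nondecreasing_seq W.
  move=> m n mn; apply/subsetPset => x Wx k /= nk; apply: Wx => /=.
  exact: leq_trans mn nk.
have mbW : measurable (\bigcup_N W N : set (measurableTypeR R)).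
  exact: bigcupT_measurable.
apply: (@le_trans _ _ (lebesgue_stieltjes_measure F (\bigcup_N W N))).
  apply: le_measure; rewrite ?inE//.
    by apply: measurableI; [exact: open_measurable|exact: measurable_itv].
  move=> x [Ux /=]; rewrite in_itv/= => /andP[ax xb].
  have [N _ NW] := approx_cover x oU Ux ax xb.
  by exists N => // n /= Nn; exact: NW.
have := nondecreasing_cvg_mu (mu := lebesgue_stieltjes_measure F) mW mbW Wnd.
move=> cvgW; rewrite -(cvg_lim _ cvgW)//; apply: lime_le.
  by apply/cvg_ex; eexists; exact: cvgW.
apply: nearW => N /=; apply: le_trans (approx_le N).
apply: le_measure; rewrite ?inE//.
by move=> x; apply => /=.
Qed.

End grid.

(** By outer regularity a null set lies in open sets of arbitrarily small measure, to which
    [stieltjes_open_le] applies. *)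
Lemma stieltjes_null_dominates {R : realType} (a b : R) (F : cumulative R R)
    (A : set (measurableTypeR R)) : a < b -> jump_continuous a b F ->
  measurable A -> lebesgue_measure A = 0%E ->
  lebesgue_stieltjes_measure F (A `&` `]a, b]) = 0%E.
Proof.
move=> hab Fac mA A0; apply/eqP; rewrite eq_le measure_ge0 andbT.
apply/lee_addgt0Pr => e /Fac[d d0 H]; rewrite add0e.
have Aoo : (lebesgue_measure A < +oo)%E by rewrite A0.
have [U [oU AU UAd]] := lebesgue_regularity_outer mA Aoo d0.
have mU : measurable (U : set (measurableTypeR R)).
  exact: open_measurable.
have Ud : (lebesgue_measure U < d%:E)%E.
  rewrite -(setDUK AU); apply: le_lt_trans UAd.
  rewrite -[leRHS]add0e -A0; apply: measureU2 => //.
  exact: measurableD.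
apply: le_trans (stieltjes_open_le _ _ _ hab F _ _ oU H Ud).
apply: le_measure; rewrite ?inE; [| |exact: setSI];
  by apply: measurableI => //; exact: measurable_itv.
Qed.

(** On []a, b[], [F] is [F a] plus the indefinite integral of the density of its Stieltjes measure
    restricted to []a, b]], and such an integral is differentiable almost everywhere. *)
Lemma cumulative_derivable {R : realType} (a b : R) (F : cumulative R R) :
  a < b -> jump_continuous a b F ->
  {ae (@lebesgue_measure R), forall x, x \in `]a, b[ -> derivable F x 1}.
Proof.
move=> hab Fac; have ab := ltW hab.
have mD : measurable (`]a, b]%classic : set (measurableTypeR R)).
  exact: measurable_itv.
have Doo : (lebesgue_stieltjes_measure F `]a, b] < +oo)%E.
  by rewrite lebesgue_stieltjes_measure_itvoc// ltry.
pose nu : {finite_measure set (measurableTypeR R) -> \bar R} :=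
  mfrestr mD Doo.
have dom : nu `<< (@lebesgue_measure R).
  apply/null_content_dominatesP => A mA A0.
  exact: stieltjes_null_dominates.
have [g [_ gfin gint gE]] := radon_nikodym_sigma_finite dom.
pose f := fine \o g.
have fg : EFin \o f = g by apply/funext => x /=; rewrite fineK.
have fint A : measurable A -> (@lebesgue_measure R).-integrable A (EFin \o f).
  by rewrite fg => mA; exact: integrableS gint.
have floc : locally_integrable setT f.
  by apply: open_integrable_locally; [exact: openT|exact: fint].
(* The bound [BRight a] makes the domain of integration []a, y]], whose Stieltjes measure is exactly
   [F y - F a]. *)
have := FTC1 (a := BRight a) (fun y => fint _ (measurable_itv _)) floc.
apply: filterS; first exact: (ae_filter_ringOfSetsType (@lebesgue_measure R)).
move=> x dx; rewrite in_itv/= => /andP[ax xb].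
have [dI _] := dx ax.
pose G := cst (F a) \+ (fun y => (\int[(@lebesgue_measure R)]_(t in [set` `]a, y]]) f t)%R).
have dG : derivable G x 1 by apply: derivableD => //; exact: derivable_cst.
apply: near_eq_derivable dG.
have : \forall y \near x, y \in `]a, b[ by apply: near_in_itvoo; rewrite in_itv/= ax.
apply: filterS => y; rewrite in_itv/= => /andP[ay yb].
rewrite /G /= /Rintegral -[X in fine X]/(\int[_]_(t in _) (EFin \o f) t)%E fg.
rewrite -gE//= /mfrestr /mrestr setIidl; last first.
  by apply: subset_itvl; rewrite bnd_simp ltW.
by rewrite lebesgue_stieltjes_measure_itvoc ?ltW//= subrKC.
Qed.

(** Composition with this projection extends a function from [[a, b]] to the line by constants,
    which yields the global continuity and monotonicity that [cumulative] demands. *)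
Definition clamp {R : realType} (a b x : R) : R := Num.max a (Num.min x b).

Lemma clamp_itv {R : realType} (a b x : R) : a <= b ->
  a <= clamp a b x <= b.
Proof. by move=> ab; rewrite /clamp le_max lexx ge_max ab ge_min lexx orbT. Qed.

Lemma clamp_id {R : realType} (a b x : R) : a <= x -> x <= b -> clamp a b x = x.
Proof. by move=> ax xb; rewrite /clamp (min_idPl xb) (max_idPr ax). Qed.

Lemma le_clamp {R : realType} (a b x y : R) : x <= y ->
  0 <= clamp a b y - clamp a b x <= y - x.
Proof.
rewrite /clamp => xy.
have [?|?] := leP x b; have [?|?] := leP y b;
  have [?|?] := leP a x; have [?|?] := leP a y; have [?|?] := leP a b;
  by apply/andP; split; lra.
Qed.

(** Families of one interval suffice; [clamp] does not increase distances, so the same [d] serves on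
    the whole line. *)
Lemma jump_continuous_clamp {R : realType} (a b : R) (f : R -> R) :
  a <= b -> jump_continuous a b f -> continuous (f \o clamp a b).
Proof.
move=> ab fac x; apply/(@cvgrPdist_le _ R^o) => e /fac[d d0 H].
have key u v : u <= v -> v - u < d ->
    `|f (clamp a b v) - f (clamp a b u)| <= e.
  move=> uv uvd; have /andP[c0 cd] := le_clamp a b _ _ uv.
  have := H [:: (clamp a b u, clamp a b v)].
  rewrite /itv_family /total_length /total_jump !big_seq1/=.
  have /andP[-> _] := clamp_itv _ _ u ab; have /andP[_ ->] := clamp_itv _ _ v ab.
  by rewrite -(subr_ge0 (clamp _ _ u)) c0; apply=> //; exact: le_lt_trans uvd.
exists d => //= y; rewrite /ball/= ltr_norml => /andP[xy yx].
have [le_xy|lt_yx] := leP x y; last by apply: key; [exact: ltW|lra].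
by rewrite distrC; apply: key => //; lra.
Qed.

(** The extension of [F] by constants is a cumulative function, and it coincides with [F] near every
    interior point. *)
Lemma nondecreasing_derivable {R : realType} (a b : R) (F : R -> R) :
  a < b -> {in `[a, b] &, nondecreasing_fun F} -> jump_continuous a b F ->
  {ae (@lebesgue_measure R), forall x, x \in `]a, b[ -> derivable F x 1}.
Proof.
move=> hab Fnd Fac; have ab := ltW hab.
pose G := F \o clamp a b.
have Gnd : nondecreasing G.
  move=> x y xy; have /andP[c0 _] := le_clamp a b _ _ xy.
  by apply: Fnd; rewrite ?in_itv/= ?clamp_itv// -subr_ge0.
have Grc := right_continuousW (jump_continuous_clamp _ _ _ ab Fac).
pose Gc : cumulative R R := HB.pack G (isCumulative.Build R _ R G Gnd Grc).
have Gac : jump_continuous a b Gc.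
  move=> eps /Fac[d d0 H]; exists d => // s fs ls.
  apply: le_trans (H s fs ls); rewrite /total_jump big_seq [leRHS]big_seq.
  apply: ler_sum => x xs; case/andP : fs => /allP/(_ _ xs)/and3P[ax xx xb] _.
  rewrite /= /G/= !clamp_id//; first exact: le_trans xb.
  exact: le_trans xx.
have := cumulative_derivable _ _ Gc hab Gac.
apply: filterS; first exact: (ae_filter_ringOfSetsType (@lebesgue_measure R)).
move=> x /= dx xab; apply: near_eq_derivable (dx xab).
have : \forall y \near x, y \in `]a, b[ by exact: near_in_itvoo.
apply: filterS => y; rewrite in_itv/= => /andP[ay yb].
by rewrite /G/= clamp_id// ltW.
Qed.

Lemma abs_continuous_derivable {R : realType} (a b : R) (f : R -> R) :
  a < b -> abs_continuous_on a b f ->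
  {ae (@lebesgue_measure R), forall x, x \in `]a, b[ -> derivable f x 1}.
Proof.
move=> hab /abs_continuous_jump /jordan_jump_continuous.
move=> [F1 [F2 [-> [nd1 ac1] [nd2 ac2]]]].
have := nondecreasing_derivable _ _ _ hab nd2 ac2.
have := nondecreasing_derivable _ _ _ hab nd1 ac1.
apply: filterS2; first exact: (ae_filter_ringOfSetsType (@lebesgue_measure R)).
move=> x d1 d2 xab; apply: derivableB; [exact: d1|exact: d2].
Qed.

(** * Convexity of the kinetic action *)

Section monotone_integral.
Import HBNNSimple.

(* No measurability is required: the integral of a nonnegative function is a
   supremum over simple functions, which can be set to 0 on a null set.  This is
   needed because the integrand of the action is only known to agree almost
   everywhere with a Borel function. *)
Lemma ge0_ae_le_integral {d : measure_display} {T : measurableType d}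
    {R : realType} (mu : {measure set T -> \bar R}) (D : set T)
    (f g : T -> \bar R) :
  (forall x, D x -> 0 <= f x)%E -> (forall x, D x -> 0 <= g x)%E ->
  {ae mu, forall x, D x -> (f x <= g x)%E} ->
  (\int[mu]_(x in D) f x <= \int[mu]_(x in D) g x)%E.
Proof.
move=> f0 g0 [N [mN N0 fgN]].
rewrite integral_mkcond [leRHS]integral_mkcond.
have fD0 x : (0 <= (f \_ D) x)%E by rewrite patchE; case: ifPn => // /set_mem/f0.
have gD0 x : (0 <= (g \_ D) x)%E by rewrite patchE; case: ifPn => // /set_mem/g0.
rewrite !ge0_integralTE//; apply: ge_ereal_sup => _ [h /= hf <-].
apply: le_ereal_sup_tmp.
have mNC : measurable (~` N) by exact: measurableC.
exists (sintegral mu (proj_nnsfun h mNC)).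
  exists (proj_nnsfun h mNC) => // x; rewrite -mrestrict.
  rewrite patchE; case: ifPn => [/set_mem Nx|_]; last exact: gD0.
  apply: le_trans (hf x) _; rewrite !patchE; case: ifPn => // /set_mem Dx.
  by apply: contrapT => fg; apply: Nx; apply: fgN => /=; apply: contra_not fg; apply.
rewrite -!integralT_nnsfun le_eqVlt; apply/orP; left; apply/eqP.
apply: ge0_ae_eq_integral => //.
- exact/measurable_EFinP.
- exact/measurable_EFinP.
- by move=> x _; rewrite lee_fin.
- by move=> x _; rewrite lee_fin.
exists N; split=> // x /=; apply: contra_notP => Nx _.
by rewrite mindicE mem_set// mulr1.
Qed.

End monotone_integral.

Lemma is_derive_log_coord {R : realType} (g : R -> R) (t : R) :
  0 < g t -> derivable g t 1 ->
  is_derive t 1 (log_coord g) (derive1 g t / g t).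
Proof.
move=> gt0 dg; rewrite mulrC derive1E.
have dln := is_derive1_ln gt0; have dgt := derivableP dg.
exact: (@is_derive1_comp R (@ln R) g t _ _ dln dgt).
Qed.

Lemma convex_coshR {R : realType} (s x y : R) : 0 <= s -> s <= 1 ->
  coshR ((1 - s) * x + s * y) <= (1 - s) * coshR x + s * coshR y.
Proof.
move=> s0 s1.
have E u v : expR ((1 - s) * u + s * v) <= (1 - s) * expR u + s * expR v.
  have := convex_expR (Itv01 s0 s1) v u.
  by rewrite !convRE /= addrC [in leRHS]addrC.
have := E x y; have := E (- x) (- y).
rewrite /coshR !mulrN -opprD; lra.
Qed.

(** Convexity at the midpoint 0 of [x] and [- x], with evenness. *)
Lemma coshR_ge1 {R : realType} (x : R) : 1 <= coshR x.
Proof.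
have := convex_coshR (1 / 2) x (- x).
have -> : (1 - 1 / 2) * x + 1 / 2 * - x = 0 by lra.
rewrite /coshR opprK oppr0 expR0; lra.
Qed.

(* Unlike the integrand of [kinetic_action], this version is visibly
   measurable; the two agree wherever [g] is differentiable. *)
Definition action_density {R : realType} (g : R -> R) (t : R) : \bar R :=
  (coshR (derive1 g t / g t) - 1)%:E.

Lemma action_density_ge0 {R : realType} (g : R -> R) (t : R) :
  (0 <= action_density g t)%E.
Proof. by rewrite lee_fin subr_ge0 coshR_ge1. Qed.

(** Derivatives are controlled on the open interval while the action integrates over the closed one;
    the two endpoints are null. *)
Lemma ae_itvcc {R : realType} (a b : R) (P : R -> Prop) :
  {ae (@lebesgue_measure R), forall t, t \in `]a, b[ -> P t} ->
  {ae (@lebesgue_measure R), forall t, `[a, b]%classic t -> P t}.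
Proof.
move=> H.
have E c : {ae (@lebesgue_measure R), forall t, t != c}.
  exists [set c]; split => //; first exact: lebesgue_measure_set1.
  by move=> t /= /negP; rewrite negbK => /eqP.
move: H (E a) (E b).
apply: filterS3; first exact: (ae_filter_ringOfSetsType (@lebesgue_measure R)).
move=> t Pt ta tb; rewrite /= in_itv/= => /andP[h1 h2]; apply: Pt.
by rewrite in_itv/= !lt_neqAle h1 h2 tb eq_sym ta.
Qed.

Lemma measurable_action_density {R : realType} (a b : R) (g : R -> R) :
  a < b -> admissible a b g ->
  measurable_fun (`[a, b]%classic : set R) (action_density g).
Proof.
move=> hab [gpos gac g2]; have ab := ltW hab.
apply/measurable_EFinP.
have gc := jump_continuous_clamp _ _ _ ab (abs_continuous_jump _ _ _ gac).
have gp t : 0 < (g \o clamp a b) t by rewrite gpos// in_itv/= clamp_itv.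
(* The path is only controlled on [[a, b]]; its extension by constants is continuous and positive
   everywhere, hence has a continuous inverse. *)
have mVg : measurable_fun setT (fun t => ((g \o clamp a b) t)^-1).
  apply: continuous_measurable_fun => t; apply: continuousV; last exact: gc.
  by rewrite gt_eqF.
(* Measurability of the derivative is part of its membership in L^2. *)
have mg : measurable_fun (`[a, b]%classic : set R) (derive1 g).
  apply/(measurable_restrictT _ _).2 => //.
  exact: set_mem (sub_Lfun_mfun g2).
have mq : measurable_fun (`[a, b]%classic : set R) (fun t => derive1 g t / g t).
  apply: (eq_measurable_fun (fun t => derive1 g t * ((g \o clamp a b) t)^-1)).
    by move=> t /set_mem; rewrite /= in_itv/= => /andP[at_ tb]; rewrite clamp_id.
  by apply: measurable_funM => //; exact: measurable_funTS.
apply: measurable_funB => //; apply: measurable_funM => //.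
by apply: measurable_funD; apply: measurableT_comp => //; exact: measurableT_comp.
Qed.

(** The integrands agree almost everywhere by the chain rule. Two inequalities are used for the
    equality, since [ge0_ae_le_integral] asks for no measurability of the original integrand. *)
Lemma kinetic_action_density {R : realType} (a b : R) (g : R -> R) :
  a < b -> admissible a b g ->
  kinetic_action a b g =
  (\int[@lebesgue_measure R]_(t in `[a, b]) action_density g t)%E.
Proof.
move=> hab [gpos gac _].
have E : {ae (@lebesgue_measure R), forall t, `[a, b]%classic t ->
    derive1 (log_coord g) t = derive1 g t / g t}.
  apply: ae_itvcc.
  have := abs_continuous_derivable _ _ _ hab gac.
  apply: filterS; first exact: (ae_filter_ringOfSetsType (@lebesgue_measure R)).
  move=> t dg tab; have gt0 := gpos t (subset_itv_oo_cc tab).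
  have [_ <-] := is_derive_log_coord _ _ gt0 (dg tab).
  by rewrite derive1E.
have ge0 x : (0 <= (coshR (derive1 (log_coord g) x) - 1)%:E)%E.
  by rewrite lee_fin subr_ge0 coshR_ge1.
rewrite /kinetic_action; apply/eqP; rewrite eq_le; apply/andP.
split; apply: ge0_ae_le_integral => //;
  try (by move=> x _; exact: action_density_ge0);
  move: E; (apply: filterS; first exact: (ae_filter_ringOfSetsType (@lebesgue_measure R)));
  by move=> t + tab => /(_ tab) ->.
Qed.

Lemma log_coord_geo_interp {R : realType} (g1 g2 : R -> R) (s t : R) :
  0 < g1 t -> 0 < g2 t ->
  log_coord (geo_interp g1 g2 s) t =
  (1 - s) * log_coord g1 t + s * log_coord g2 t.
Proof.
move=> g1t g2t; rewrite /log_coord /geo_interp.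
by rewrite lnM ?posrE ?powR_gt0// !ln_powR.
Qed.

(** Adding the integrals on the right takes measurability, hence the passage to [action_density]
    there. The left side keeps its original integrand and is compared almost everywhere by
    [ge0_ae_le_integral]. *)
Lemma kinetic_action_geo_interp {R : realType} (a b s : R) (g1 g2 : R -> R) :
  a < b -> 0 <= s -> s <= 1 -> admissible a b g1 -> admissible a b g2 ->
  (kinetic_action a b (geo_interp g1 g2 s) <=
   (1 - s)%:E * kinetic_action a b g1 + s%:E * kinetic_action a b g2)%E.
Proof.
move=> hab s0 s1 ag1 ag2.
rewrite (kinetic_action_density _ _ g1)// (kinetic_action_density _ _ g2)//.
have mu1 := measurable_action_density _ _ _ hab ag1.
have mu2 := measurable_action_density _ _ _ hab ag2.
have s10 : 0 <= 1 - s by rewrite subr_ge0.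
have wt_ge0 (r : R) g x : 0 <= r -> (0 <= r%:E * action_density g x)%E.
  by move=> r0; apply: mule_ge0; [rewrite lee_fin|exact: action_density_ge0].
rewrite -!ge0_integralZl_EFin//; try by move=> *; exact: action_density_ge0.
rewrite -ge0_integralD//=; first last.
- exact: emeasurable_funM.
- by move=> x _; exact: wt_ge0.
- exact: emeasurable_funM.
- by move=> x _; exact: wt_ge0.
case: ag1 ag2 => [g1pos g1ac _] [g2pos g2ac _].
apply: ge0_ae_le_integral.
- by move=> x _; rewrite lee_fin subr_ge0 coshR_ge1.
- by move=> x _; apply: adde_ge0; exact: wt_ge0.
apply: ae_itvcc.
have := abs_continuous_derivable _ _ _ hab g2ac.
have := abs_continuous_derivable _ _ _ hab g1ac.
apply: filterS2; first exact: (ae_filter_ringOfSetsType (@lebesgue_measure R)).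
move=> t dg1 dg2 tab.
have pos y : y \in `]a, b[ -> 0 < g1 y /\ 0 < g2 y.
  by move=> /subset_itv_oo_cc yab; split; [exact: g1pos|exact: g2pos].
have [g1t g2t] := pos t tab.
have d1 := is_derive_log_coord _ _ g1t (dg1 tab).
have d2 := is_derive_log_coord _ _ g2t (dg2 tab).
have -> : derive1 (log_coord (geo_interp g1 g2 s)) t =
    (1 - s) * (derive1 g1 t / g1 t) + s * (derive1 g2 t / g2 t).
  rewrite derive1E.
  have [_ <-] : is_derive t 1
      ((1 - s) \*: log_coord g1 \+ s \*: log_coord g2)
      ((1 - s) * (derive1 g1 t / g1 t) + s * (derive1 g2 t / g2 t)).
    exact: is_deriveD.
  (* Both paths are positive on []a, b[], so the log-coordinate of the interpolation is affine in
     [s] on a neighbourhood of [t], not just at [t]. *)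
  apply: near_eq_derive.
  have : \forall y \near t, y \in `]a, b[ by exact: near_in_itvoo.
  by apply: filterS => y /pos[? ?]; rewrite log_coord_geo_interp.
rewrite /action_density -!EFinM -EFinD lee_fin.
have := convex_coshR s (derive1 g1 t / g1 t) (derive1 g2 t / g2 t) s0 s1.
lra.
Qed.

Theorem theorem4p7 (R : realType) (a b : R) (hab : a < b)
    (g_geo : R -> R) (hgeo : kinetically_admissible a b g_geo)
    (hloc : forall g_other : R -> R,
       kinetically_admissible a b g_other ->
       same_endpoints a b g_other g_geo ->
       exists s0 : R, [/\ 0 < s0, s0 < 1 &
         (kinetic_action a b g_geo <=
          kinetic_action a b (geo_interp g_geo g_other s0))%E]) :
  global_minimizer a b g_geo.
Proof.
split; first exact: hgeo.
move=> h hh hends.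
have [s [s0 s1]] := hloc h hh hends.
case: hgeo hh => [ag fg] [ah fh].
move=> /le_trans/(_ (kinetic_action_geo_interp _ _ _ _ _ hab (ltW s0) (ltW s1) ag ah)).
have pos g : (0 <= kinetic_action a b g)%E.
  by apply: integral_ge0 => x _; rewrite lee_fin subr_ge0 coshR_ge1.
(* Both actions are nonnegative and finite, hence real numbers, among which [x] can be cancelled. *)
move: (pos g_geo) (pos h) fg fh.
case: (kinetic_action a b g_geo) => [x| |]//.
case: (kinetic_action a b h) => [y| |]// _ _ _ _.
rewrite -!EFinM -EFinD !lee_fin => xy.
(* The bound [x <= (1 - s) * x + s * y] amounts to [s * x <= s * y]. *)
rewrite -(ler_pM2l s0); lra.
Qed.
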